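(* Let $n>4$ be an integer. Let $W_{2n+1}^+$ be the $(2n+1)\times(2n+1)$ real symmetric tridiagonal matrix with diagonal entries $n,n-1,\dots,1,0,1,\dots,n-1,n$ and all sub- and superdiagonal entries equal to $1$. Let $E$ be the $(2n+1)\times(2n+1)$ matrix whose only nonzero entries are $E_{n,n+1}=E_{n+1,n}=E_{n+1,n+2}=E_{n+2,n+1}=1$, and let $A=W_{2n+1}^+-E$. Then for the two largest eigenvalues, that is, for $i=2n$ and $i=2n+1$, $$|\lambda_i(A+E)-\lambda_i(A)|\le \frac{4}{3n}\left(\prod_{\ell=1}^{n-2}\frac{1}{n-\ell-1}\right)^2 .$$
   Context: For a Hermitian matrix $X$, $\lambda_i(X)$ denotes the $i$th smallest eigenvalue of $X$, counted with multiplicity. The matrix $A$ is block diagonal with two $n\times n$ tridiagonal blocks (which are reversals of each other) separated by a zero row and column, so its largest eigenvalue is repeated. *)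

(* Defs.v *)
From mathcomp Require Import all_boot all_order all_algebra.
From mathcomp Require Import reals.
From mathcomp Require Import complex.

Set Implicit Arguments.
Unset Strict Implicit.
Unset Printing Implicit Defensive.

Import Order.TTheory GRing.Theory Num.Theory.
Local Open Scope ring_scope.
Local Open Scope complex_scope.

(* The eigenvalues of X are the roots of its characteristic polynomial, each
   repeated according to its multiplicity.  For Hermitian X they are all real,
   so that taking real parts only serves to land in the ordered field R. *)
Definition eigenvalues (R : realType) (m : nat) (X : 'M[R[i]]_m) : seq R :=
  sort <=%R
    [seq complex.Re z | z <- sval (closed_field_poly_normal (char_poly X))].

(* i-th smallest eigenvalue, with i counted from 1; meaningful for Hermitian X
   of size m and 1 <= i <= m. *)
Definition lambda (R : realType) (m i : nat) (X : 'M[R[i]]_m) : R :=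
  nth 0 (eigenvalues X) i.-1.

(* Matrix indices are 0-based: the 1-based row and column numbers are
   i.+1 and j.+1. *)
Definition wilkinson (R : realType) (n : nat) : 'M[R]_(2 * n + 1) :=
  \matrix_(i, j)
    if i == j then `|n.+1%:R - i.+1%:R|
    else ((i.+1 == j) || (j.+1 == i))%:R.

Definition coupling (R : realType) (n : nat) : 'M[R]_(2 * n + 1) :=
  \matrix_(i, j)
    ((i.+1, j.+1) \in
       [:: (n, n.+1); (n.+1, n); (n.+1, n.+2); (n.+2, n.+1)])%:R.

(* Main.v *)
Require Import Defs.
From mathcomp Require Import all_boot all_order all_algebra.
From mathcomp Require Import reals.
From mathcomp Require Import complex polyrcf zify ring lra.

Set Implicit Arguments.
Unset Strict Implicit.
Unset Printing Implicit Defensive.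

Import Order.TTheory GRing.Theory Num.Theory.
Local Open Scope ring_scope.
Local Open Scope complex_scope.

(* Let [P_k] be the characteristic polynomial of the leading [k x k] block of
   [W]. The reversal symmetry gives [char W = P_n * Q], [Q = X P_n - 2 P_(n-1)],
   while [char A = X * P_n ^ 2], and [Q] is again the last term of a three-term
   recurrence with positive coefficients. By the Christoffel-Darboux identity
   the largest root [nu] of [Q] is simple and the only one above the largest
   root [mu] of [P_n], so only the top eigenvalue moves, from [mu] to [nu].
   The same identity at [(nu, mu)] bounds [nu - mu] by
   [P_n(nu) P_(n-1)(mu) = (2 / nu) P_(n-1)(nu) P_(n-1)(mu)], and
   [P_(j-1) >= j P_j] on the right of [n + 1/2] makes both factors at most
   [1 / (n-1)!]. *)

(** * Tridiagonal determinants and their three-term recurrence *)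

Definition tridiag (F : comNzRingType) (a b : nat -> F) (m : nat) : 'M[F]_m :=
  \matrix_(i, j) if i == j :> nat then a i
                 else if i.+1 == j then b i
                 else if j.+1 == i then b j else 0.

Lemma bump_lt (h k : nat) : (k < h)%N -> bump h k = k.
Proof. by rewrite /bump ltnNge => /negbTE->. Qed.

Lemma det_tridiag_rec (F : comNzRingType) (a b : nat -> F) (m : nat) :
  \det (tridiag a b m.+2) =
    a m.+1 * \det (tridiag a b m.+1) - b m ^+ 2 * \det (tridiag a b m).
Proof.
rewrite (expand_det_row _ ord_max) big_ord_recr /= big_ord_recr /= big1 ?add0r.
  rewrite addrC; congr (_ + _).
    rewrite /cofactor !mxE /= eqxx addnn -signr_odd odd_double expr0 mul1r.
    congr (_ * \det _); apply/matrixP=> i j.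
    by rewrite !mxE /= !bump_lt.
  rewrite /cofactor !mxE /= eqxx ifF ?ifF ?addSn ?addnn; try lia.
  rewrite -signr_odd /= odd_double expr1.
  (* The minor at column [m] keeps a last column whose only nonzero entry is [b m], at the bottom;
     expanding along it yields the second factor [b m]. *)
  set B := row' _ _; rewrite (expand_det_col B ord_max) big_ord_recr /= big1.
    rewrite add0r /cofactor addnn -signr_odd odd_double expr0 mul1r.
    rewrite !mxE /= bump_lt // /bump leqnn add1n eqxx ltn_eqF //.
    rewrite expr2 mulN1r mulrN mulrA; congr (- (_ * \det _)).
    apply/matrixP=> i j; rewrite !mxE /=.
    by rewrite !(@bump_lt m) // !bump_lt // ltnS ltnW.
  move=> i _; have hi := ltn_ord i.
  rewrite !mxE /= bump_lt ?ltnS ?(ltnW hi) // /bump leqnn add1n.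
  by rewrite !ifF ?mul0r //; lia.
move=> i _; rewrite !mxE /= !ifF ?mul0r //; have := ltn_ord i; lia.
Qed.

(** Here [c] stands for the squares of the off-diagonal entries. A coupling of square 2 thus needs
    no square root in [F]. *)
Fixpoint continuant (F : comNzRingType) (d c : nat -> F) (k : nat) : {poly F} :=
  match k with
  | 0 => 1
  | k1.+1 => match k1 with
    | 0 => 'X - (d 0)%:P
    | k2.+1 => ('X - (d k1)%:P) * continuant d c k1
               - (c k2)%:P * continuant d c k2
    end
  end.

Lemma continuantSS (F : comNzRingType) (d c : nat -> F) (k : nat) :
  continuant d c k.+2 =
    ('X - (d k.+1)%:P) * continuant d c k.+1 - (c k)%:P * continuant d c k.
Proof. by []. Qed.

Lemma continuant_ind2 (P : nat -> Prop) :
  P 0 -> P 1 -> (forall k, P k -> P k.+1 -> P k.+2) -> forall k, P k.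
Proof. by move=> P0 P1 PS k; suff []: P k /\ P k.+1 by []; elim: k => // k []; auto. Qed.

Lemma char_poly_tridiag (F : comNzRingType) (d e : nat -> F) (m : nat) :
  char_poly (tridiag d e m) = continuant d (fun i => e i ^+ 2) m.
Proof.
have cE k : char_poly (tridiag d e k) =
    \det (tridiag (fun i => 'X - (d i)%:P) (fun i => - (e i)%:P) k).
  congr (\det _); apply/matrixP=> i j; rewrite !mxE -val_eqE /=.
  case: ifP => // _; rewrite mulr0n sub0r.
  by do 2![case: ifP => // _]; rewrite oppr0.
rewrite cE; elim/continuant_ind2: m => [|| k IH1 IH2].
- by rewrite det_mx00.
- by rewrite det_mx11 mxE.
- by rewrite det_tridiag_rec IH1 IH2 continuantSS sqrrN polyC_exp.
Qed.

Lemma eq_continuant (F : comNzRingType) (d d' c c' : nat -> F) (k : nat) :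
  (forall i, (i < k)%N -> d i = d' i) ->
  (forall i, (i.+1 < k)%N -> c i = c' i) ->
  continuant d c k = continuant d' c' k.
Proof.
elim/continuant_ind2: k => [||k IH1 IH2] hd hc //; first by rewrite /= hd.
rewrite !continuantSS hd // hc // IH1 ?IH2 // => i hi;
  by [apply: hd; lia | apply: hc; lia].
Qed.

(* Expanding a determinant at an interior edge; for a palindromic matrix the
   trailing minors are the leading ones. *)
Lemma continuant_split (F : comNzRingType) (d c : nat -> F) (m j : nat) :
  (forall i, (i < m)%N -> d (m - i.+1)%N = d i) ->
  (forall i, (i.+1 < m)%N -> c (m - i.+2)%N = c i) ->
  (j.+1 < m)%N ->
  continuant d c m = continuant d c j.+1 * continuant d c (m - j.+1)
    - (c j)%:P * continuant d c j * continuant d c (m - j.+2).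
Proof.
move=> hd hc; elim: j => [|j IH] hj.
  case: m hj hd hc => [|[|m]] // _ hd hc.
  rewrite !subSS !subn0 continuantSS /= mulr1.
  by rewrite -(hd m.+1) // -(hc m) // !subnn.
rewrite IH; last by lia.
have [k Ek] : exists k, m = (k + j.+3)%N by exists (m - j.+3)%N; lia.
have -> : (m - j.+1 = k.+2)%N by lia.
have -> : (m - j.+2 = k.+1)%N by lia.
have -> : (m - j.+3 = k)%N by lia.
rewrite !continuantSS -(hd j.+1) -?(hc j.+1); try lia.
have -> : (m - j.+2 = k.+1)%N by lia.
have -> : (m - j.+3 = k)%N by lia.
ring.
Qed.

(** * The Christoffel-Darboux identity and the largest root *)

(* The Christoffel-Darboux kernel [sum_(j <= k) c_j ... c_(k-1) P_j(x) P_j(y)]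
   of the continuants [P_j]. *)
Fixpoint christoffel (F : comNzRingType) (d c : nat -> F) (x y : F) (k : nat) : F :=
  match k with
  | 0 => 1
  | k1.+1 => (continuant d c k).[x] * (continuant d c k).[y]
             + c k1 * christoffel d c x y k1
  end.

Lemma horner_continuantSS (F : comNzRingType) (d c : nat -> F) (x : F) (k : nat) :
  (continuant d c k.+2).[x] = (x - d k.+1) * (continuant d c k.+1).[x]
                              - c k * (continuant d c k).[x].
Proof. by rewrite continuantSS !hornerE. Qed.

Lemma christoffel_darboux (F : comNzRingType) (d c : nat -> F) (x y : F) (k : nat) :
  (continuant d c k.+1).[x] * (continuant d c k).[y]
    - (continuant d c k.+1).[y] * (continuant d c k).[x]
  = (x - y) * christoffel d c x y k.
Proof.
elim: k => [|k IH]; first by rewrite /= !hornerE; ring.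
rewrite [christoffel _ _ _ _ _]/= mulrDr [X in _ = _ + X]mulrCA -IH !horner_continuantSS; ring.
Qed.

(** The confluent case [y = x] of the identity, where the difference quotient becomes a
    derivative. *)
Lemma christoffel_darboux_deriv (F : comNzRingType) (d c : nat -> F) (x : F) (k : nat) :
  (continuant d c k.+1)^`().[x] * (continuant d c k).[x]
    - (continuant d c k.+1).[x] * (continuant d c k)^`().[x]
  = christoffel d c x x k.
Proof.
elim: k => [|k IH]; first by rewrite /= !derivE !hornerE; ring.
rewrite [christoffel _ _ _ _ _]/= -IH !horner_continuantSS continuantSS.
by rewrite !derivE !hornerE; ring.
Qed.

Lemma christoffel_gt0 (R : numDomainType) (d c : nat -> R) (x y : R) (k : nat) :
  (forall j, 0 < c j) ->
  (forall j, (j <= k)%N ->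
     0 < (continuant d c j).[x] /\ 0 < (continuant d c j).[y]) ->
  0 < christoffel d c x y k.
Proof.
move=> hc; elim: k => [|k IH] hP; first exact: ltr01.
have [Px Py] := hP k.+1 (leqnn _).
rewrite /= addr_gt0 ?mulr_gt0 //; apply: IH => j hj; exact/hP/leqW.
Qed.

(** The summand of index 0 is a product of the [c j], hence at least 1, and the other summands are
    positive. *)
Lemma christoffel_ge1 (R : numDomainType) (d c : nat -> R) (x y : R) (k : nat) :
  (forall j, 1 <= c j) ->
  (forall j, (j <= k)%N ->
     0 < (continuant d c j).[x] /\ 0 < (continuant d c j).[y]) ->
  1 <= christoffel d c x y k.
Proof.
move=> hc; elim: k => [|k IH] hP //.
have [Px Py] := hP k.+1 (leqnn _).
have D1 : 1 <= christoffel d c x y k by apply: IH => j hj; exact/hP/leqW.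
apply: (le_trans (mulr_ege1 (hc k) D1)).
by rewrite [christoffel _ _ _ _ k.+1]/= lerDr mulr_ge0 ?ltW.
Qed.

(** At two roots the left side of Christoffel-Darboux vanishes, while the kernel on the right is
    positive. *)
Lemma continuant_root_uniq (R : numDomainType) (d c : nat -> R) (x y : R) (k : nat) :
  (forall j, 0 < c j) ->
  (forall j, (j <= k)%N ->
     0 < (continuant d c j).[x] /\ 0 < (continuant d c j).[y]) ->
  root (continuant d c k.+1) x -> root (continuant d c k.+1) y -> x = y.
Proof.
move=> hc hP /rootP Px /rootP Py.
have := christoffel_darboux d c x y k; rewrite Px Py !mul0r subrr => /esym/eqP.
by rewrite mulf_eq0 (gt_eqF (christoffel_gt0 hc hP)) orbF subr_eq0 => /eqP.
Qed.

Lemma continuant_root_simple (R : numDomainType) (d c : nat -> R) (x : R) (k : nat) :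
  (forall j, 0 < c j) -> (forall j, (j <= k)%N -> 0 < (continuant d c j).[x]) ->
  root (continuant d c k.+1) x -> (continuant d c k.+1)^`().[x] != 0.
Proof.
move=> hc hP /rootP Px; have := christoffel_darboux_deriv d c x k.
rewrite Px mul0r subr0; apply: contra_eq_neq => ->; rewrite mul0r lt_eqF //.
by apply: christoffel_gt0 => // j /hP.
Qed.

Lemma continuant_monic (F : comNzRingType) (d e : nat -> F) (k : nat) :
  continuant d (fun i => e i ^+ 2) k \is monic.
Proof. by rewrite -char_poly_tridiag char_poly_monic. Qed.

(** Interlacing by induction: at the largest root [mu] of P_(k+1) the recurrence leaves P_(k+2)(mu)
    = - c_k P_k(mu) < 0, so P_(k+2) has a root beyond [mu]. *)
Lemma continuant_top_root (R : rcfType) (d c : nat -> R) (k : nat) :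
  (forall j, 0 < c j) ->
  exists mu, [/\ root (continuant d c k.+1) mu,
    forall x j, mu <= x -> (j <= k)%N -> 0 < (continuant d c j).[x] &
    forall x, mu < x -> 0 < (continuant d c k.+1).[x]].
Proof.
move=> hc; elim: k => [|k [mu [mu_root mu_ge mu_gt]]].
  exists (d 0); split=> [|x [|//] _ _|x hx]; last by rewrite /= !hornerE subr_gt0.
    by rewrite /= root_XsubC.
  by rewrite hornerE.
set P := continuant d c k.+2.
have P_monic : P \is monic.
  (* Monicity comes from a characteristic polynomial, so the positive [c i] are written as
     squares. *)
  have -> : P = continuant d (fun i => Num.sqrt (c i) ^+ 2) k.+2.
    by apply: eq_continuant => // i _; rewrite sqr_sqrtr // ltW.
  exact: continuant_monic.
have Pmu : P.[mu] < 0.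
  by rewrite horner_continuantSS (rootP mu_root) mulr0 sub0r oppr_lt0 mulr_gt0 // mu_ge.
have [M hM] : exists M, forall x, M <= x -> 1 <= P.[x].
  have := @poly_pinfty_gt_lc _ P; rewrite (monicP P_monic); apply; exact: ltr01.
have PM : 0 < P.[Num.max M mu].
  by apply: (lt_le_trans ltr01); apply: hM; rewrite le_max lexx.
have [||nu /andP[mu_nu _] nu_root] :=
    @Num.Theory.poly_ivt _ P mu (Num.max M mu).
- by rewrite le_max lexx orbT.
- by rewrite !ltW.
have {}mu_nu : mu < nu.
  rewrite lt_neqAle mu_nu andbT; apply: contraTneq nu_root => <-.
  by rewrite rootE lt_eqF.
have nu_ge x j : nu <= x -> (j <= k.+1)%N -> 0 < (continuant d c j).[x].
  move=> nu_x; rewrite leq_eqVlt => /predU1P[->|hj].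
    by apply: mu_gt; apply: lt_le_trans nu_x.
  by apply: mu_ge => //; apply: le_trans nu_x; apply: ltW.
exists nu; split=> // x nu_x.
(* With [y] at the root [nu], the identity makes the sign of P_(k+2)(x) that of [x - nu]. This shows
   that no root lies beyond [nu]. *)
have := christoffel_darboux d c x nu k.+1.
rewrite (rootP nu_root) mul0r subr0 => E.
have := nu_ge nu k.+1 (lexx _) (leqnn _) => /pmulr_lgt0 <-.
rewrite E mulr_gt0 ?subr_gt0 //; apply: christoffel_gt0 => // j hj.
by split; apply: nu_ge => //; apply: ltW.
Qed.

(** Downward induction from [n]. Since x - d_(j+1) >= j + 3/2, the recurrence gives P_j >= (j + 3/2)
    P_(j+1) - P_(j+2), and P_(j+2) <= P_(j+1) / 2 leaves the factor j + 1. This is where the margin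
    1/2 in the bound on [x] is spent. *)
Lemma continuant_decay (R : realFieldType) (d c : nat -> R) (n : nat) (x : R) :
  (forall i, (i < n)%N -> d i = n%:R - i%:R) ->
  (forall i, (i.+1 < n)%N -> c i = 1) ->
  n%:R + 1 / 2 <= x ->
  (forall j, (j < n)%N -> 0 < (continuant d c j).[x]) ->
  2 * (continuant d c n).[x] <= (continuant d c n.-1).[x] ->
  forall j, (j < n)%N -> j`!%:R * (continuant d c j).[x] <= 1.
Proof.
move=> hd hc hx hP hn.
(* The induction variable [t] is the distance of j + 2 from [n]. *)
have step t j : (j.+2 + t = n)%N ->
    j.+1%:R * (continuant d c j.+1).[x] <= (continuant d c j).[x].
  elim: t j => [|t IH] j E.
    have P2 : 2 * (continuant d c j.+2).[x] <= (continuant d c j.+1).[x].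
      by move: hn; rewrite -E addn0.
    have P1 : 0 < (continuant d c j.+1).[x] by apply: hP; lia.
    move: P2; rewrite horner_continuantSS hd ?hc; try lia.
    rewrite -[j.+1%:R]natr1; nra.
  have P2 : 2 * (continuant d c j.+2).[x] <= (continuant d c j.+1).[x].
    apply: le_trans (IH j.+1 _); last by lia.
    by rewrite ler_pM2r ?hP ?ler_nat //; lia.
  have P1 : 0 < (continuant d c j.+1).[x] by apply: hP; lia.
  move: P2; rewrite horner_continuantSS hd ?hc; try lia.
  rewrite -[j.+1%:R]natr1; nra.
elim=> [|j IH] hj; first by rewrite fact0 mul1r hornerC.
apply: le_trans (IH (ltnW hj)).
rewrite factS mulnC natrM -mulrA ler_wpM2l ?ler0n //.
by apply: (step (n - j.+2)%N); lia.
Qed.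

(** * Symmetric matrices: real spectrum and sorted eigenvalues *)

(** For a left eigenvector [v] with conjugate [w], the product v Y w^T equals both z and its
    conjugate times v w^T, a nonzero sum of squared moduli. *)
Lemma symmetric_root_real (R : rcfType) (m : nat) (X : 'M[R]_m) (z : R[i]) :
  X^T = X -> root (char_poly (map_mx (real_complex R) X)) z ->
  (complex.Re z)%:C = z.
Proof.
move=> Xsym; rewrite -eigenvalue_root_char => /eigenvalueP[v vX v0].
set Y := map_mx _ _ in vX; pose w := map_mx (@conjc R) v.
have Yw : Y *m w^T = z^*%C *: w^T.
  have -> : Y = Y^T by rewrite /Y map_trmx Xsym.
  rewrite -trmx_mul -linearZ /=; congr (_^T).
  have <- : map_mx (@conjc R) Y = Y.
    by apply/matrixP=> i j; rewrite !mxE conjc_real.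
  by rewrite -map_mxM vX map_mxZ.
have E : (z - z^*%C) * (v *m w^T) 0 0 = 0.
  suff : z *: (v *m w^T) = z^*%C *: (v *m w^T).
    by move=> /matrixP/(_ 0 0); rewrite !mxE mulrBl => ->; rewrite subrr.
  by rewrite scalemxAl -vX -mulmxA Yw scalemxAr.
have vw0 : (v *m w^T) 0 0 != 0.
  apply: contra v0; rewrite mxE psumr_eq0 => [/allP v0|j _]; last first.
    by rewrite !mxE mulcJ_ge0.
  apply/eqP/rowP=> j; have := v0 j (mem_index_enum _).
  by rewrite !mxE mulf_eq0 conjc_eq0 orbb => /eqP.
move/eqP: E; rewrite mulf_eq0 (negbTE vw0) orbF subr_eq0 eq_complex.
case: z {vX Yw} => a b /= /andP[_ b0]; congr (_ +i* _).
by apply/eqP; move: b0; rewrite eq_sym eqNr eq_sym.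
Qed.

(** All complex roots are real, so the splitting over [R[i]] is the image of one over [R], and
    mapping polynomials is injective. *)
Lemma char_poly_eigenvalues (R : realType) (m : nat) (X : 'M[R]_m) :
  X^T = X ->
  char_poly X =
    \prod_(r <- eigenvalues (map_mx (real_complex R) X)) ('X - r%:P).
Proof.
move=> Xsym; rewrite /eigenvalues; set Y := map_mx _ _.
case: closed_field_poly_normal => s /=.
rewrite (monicP (char_poly_monic _)) scale1r => Ys.
apply: (map_poly_inj (real_complex R)).
rewrite map_char_poly -/Y Ys rmorph_prod /=.
rewrite (perm_big _ (permEl (perm_sort _ _))) big_map /=.
apply: eq_big_seq => z zs.
rewrite rmorphB /= map_polyX map_polyC /= (symmetric_root_real Xsym) //.
by rewrite -/Y Ys root_prod_XsubC.
Qed.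

(** Removing [a] and [b] from [t] leaves the roots of [h], all at most [b]; uniqueness of the sorted
    permutation puts [b], [a] at the end. The case [a = b] is allowed, as the uncoupled matrix has a
    double top eigenvalue. *)
Lemma sorted_prod_XsubC_top2 (R : realFieldType) (t : seq R) (a b : R)
    (h : {poly R}) :
  sorted <=%R t ->
  \prod_(r <- t) ('X - r%:P) = ('X - a%:P) * ('X - b%:P) * h ->
  b <= a -> (forall r, root h r -> r <= b) ->
  nth 0 t (size t).-1 = a /\ nth 0 t (size t).-2 = b.
Proof.
move=> t_sorted tE ba hb.
have at_ : a \in t by rewrite -root_prod_XsubC tE !rootM root_XsubC eqxx.
have E1 : \prod_(r <- rem a t) ('X - r%:P) = ('X - b%:P) * h.
  apply: (mulfI (negbT (polyXsubC_eq0 a))).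
  by rewrite mulrA -tE (perm_big _ (perm_to_rem at_)) big_cons.
have bt : b \in rem a t by rewrite -root_prod_XsubC E1 !rootM root_XsubC eqxx.
have E2 : \prod_(r <- rem b (rem a t)) ('X - r%:P) = h.
  apply: (mulfI (negbT (polyXsubC_eq0 b))).
  by rewrite -E1 (perm_big _ (perm_to_rem bt)) big_cons.
set u := rem b (rem a t) in E2.
have ub r : r \in u -> r <= b by rewrite -root_prod_XsubC E2; apply: hb.
have -> : t = rcons (rcons (sort <=%R u) b) a.
  apply: (sorted_eq le_trans le_anti) => //.
    rewrite !(sorted_pairwise le_trans) !pairwise_rcons all_rcons ba /=.
    rewrite -(sorted_pairwise le_trans) sort_le_sorted andbT.
    apply/andP; split; apply/allP=> r; rewrite mem_sort => /ub //.
    by move=> /le_trans; apply.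
  apply: perm_trans (perm_to_rem at_) _.
  rewrite perm_sym perm_rcons perm_cons perm_rcons perm_sym.
  apply: perm_trans (perm_to_rem bt) _.
  by rewrite perm_cons perm_sym perm_sort.
by rewrite !size_rcons /= !nth_rcons size_rcons !ltnn !eqxx ltnSn.
Qed.

(** * Characteristic polynomials of the two matrices *)

Definition wdiag (R : numDomainType) (n i : nat) : R := `|n%:R - i%:R|.

Lemma wilkinson_tridiag (R : realType) (n : nat) :
  wilkinson R n = tridiag (wdiag R n) (fun=> 1) (2 * n + 1).
Proof.
apply/matrixP=> i j; rewrite !mxE -val_eqE /wdiag.
case: ifP => _; first by rewrite -!natr1 opprD addrACA subrr addr0.
by case: (i.+1 == j); case: (j.+1 == i).
Qed.

Lemma uncoupled_tridiag (R : realType) (n : nat) :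
  wilkinson R n - coupling R n =
    tridiag (wdiag R n) (fun i => ((i.+1 != n) && (i != n))%:R) (2 * n + 1).
Proof.
rewrite wilkinson_tridiag; apply/matrixP=> i j; rewrite !mxE !inE !xpair_eqE.
have [ij|ij] := eqVneq (i : nat) j.
  by rewrite (_ : (_ || _) = false) ?subr0 //; lia.
have [ij1|ij1] := eqVneq i.+1 (j : nat).
  rewrite (_ : (_ || _) = ~~ ((i.+1 != n) && (i != n :> nat))); last by lia.
  by case: (_ && _); rewrite ?subr0 ?subrr.
have [ij2|ij2] := eqVneq j.+1 (i : nat).
  rewrite (_ : (_ || _) = ~~ ((j.+1 != n) && (j != n :> nat))); last by lia.
  by case: (_ && _); rewrite ?subr0 ?subrr.
by rewrite (_ : (_ || _) = false) ?subr0 //; lia.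
Qed.

Lemma tridiag_sym (F : comNzRingType) (a b : nat -> F) (m : nat) :
  (tridiag a b m)^T = tridiag a b m.
Proof.
apply/matrixP=> i j; rewrite !mxE eq_sym; case: eqVneq => [->//|_].
by do 2![case: eqVneq => // ?]; lia.
Qed.

Lemma wdiag_rev (R : numDomainType) (n i : nat) :
  (i < 2 * n + 1)%N -> wdiag R n (2 * n + 1 - i.+1) = wdiag R n i.
Proof.
move=> hi; have -> : (2 * n + 1 - i.+1 = n + n - i)%N by lia.
rewrite /wdiag natrB ?natrD; last by lia.
by rewrite distrC; congr `|_|; ring.
Qed.

(* The squared couplings of the even part of [wilkinson R n] under the reversal
   symmetry: the coupling to the central index is [sqrt 2]. *)
Definition even_coupling (R : numDomainType) (n i : nat) : R := (i.+1 == n).+1%:R.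

(** Cutting at the edge just after the centre gives P_n (X P_n - P_(n-1)) - P_n P_(n-1) with unit
    couplings; the doubled P_(n-1) is the central coupling 2 of the even part. *)
Lemma char_poly_wilkinson (R : realType) (n : nat) : (0 < n)%N ->
  char_poly (wilkinson R n) =
    continuant (wdiag R n) (even_coupling R n) n
    * continuant (wdiag R n) (even_coupling R n) n.+1.
Proof.
case: n => // n _; rewrite wilkinson_tridiag char_poly_tridiag.
rewrite (@continuant_split _ _ _ _ n.+1) //; last 2 first.
- exact: wdiag_rev.
- by lia.
have -> : (2 * n.+1 + 1 - n.+2 = n.+1)%N by lia.
have -> : (2 * n.+1 + 1 - n.+3 = n)%N by lia.
rewrite !(@continuantSS _ _ _ n).
have cE k : (k <= n.+1)%N ->
    continuant (wdiag R n.+1) (even_coupling R n.+1) k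
    = continuant (wdiag R n.+1) (fun=> 1 ^+ 2) k.
  move=> hk; apply: eq_continuant => // i hi.
  by rewrite /even_coupling ltn_eqF ?expr1n //; lia.
by rewrite !cE // /even_coupling eqxx expr1n polyC1 polyC_natr -[true.+1]/2%N; ring.
Qed.

(** The same cut, now at an edge of weight 0; the centre contributes the factor ['X]. *)
Lemma char_poly_uncoupled (R : realType) (n : nat) : (0 < n)%N ->
  char_poly (wilkinson R n - coupling R n) =
    'X * continuant (wdiag R n) (even_coupling R n) n ^+ 2.
Proof.
case: n => // n _; rewrite uncoupled_tridiag char_poly_tridiag.
rewrite (@continuant_split _ _ _ _ n.+1) //; first last.
- by lia.
- move=> i hi; congr (_%:R ^+ 2); congr nat_of_bool; apply/idP/idP; lia.
- exact: wdiag_rev.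
have -> : (2 * n.+1 + 1 - n.+2 = n.+1)%N by lia.
rewrite (@continuantSS _ _ _ n) !eqxx andbF expr0n polyC0 !mul0r !subr0.
rewrite {1}/wdiag subrr normr0 subr0 -mulrA -expr2; congr (_ * _ ^+ 2).
apply: eq_continuant => // i hi.
have -> : (i.+1 != n.+1) && (i != n.+1) by lia.
by rewrite /even_coupling ltn_eqF // expr1n.
Qed.

(** * The two largest eigenvalues and the gap between them *)

Lemma prod_inv_fact (R : numFieldType) (m : nat) :
  \prod_(1 <= l < m.+1) (1 / (m.+2%:R - l%:R - 1)) = (m`!%:R)^-1 :> R.
Proof.
rewrite fact_prod natr_prod -prodfV big_nat_rev /=; apply: eq_big_nat => l hl.
have -> : (1 + m.+1 - l.+1 = m.+1 - l)%N by lia.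
rewrite natrB; last by lia.
by rewrite mul1r; congr (_^-1); rewrite -natr1; ring.
Qed.

Lemma wilkinson_top_eigenvalues (R : realType) (n : nat) : (1 < n)%N ->
  let P := continuant (wdiag R n) (even_coupling R n) in
  let A := map_mx (real_complex R) (wilkinson R n - coupling R n) in
  let W := map_mx (real_complex R) (wilkinson R n) in
  exists mu nu,
    [/\ [/\ mu <= nu, root (P n) mu, root (P n.+1) nu
          & forall j, (j < n)%N -> forall x, mu <= x -> 0 < (P j).[x]],
        lambda (2 * n) W = lambda (2 * n) A &
        lambda (2 * n + 1) W - lambda (2 * n + 1) A = nu - mu].
Proof.
move=> n1 P A W.
have hc j : 0 < even_coupling R n j by rewrite ltr0n.
have [mu [mu_root mu_ge mu_gt]] := continuant_top_root (wdiag R n) n.-1 hc.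
have [nu [nu_root nu_ge _]] := continuant_top_root (wdiag R n) n hc.
rewrite prednK in mu_root mu_gt; last by lia.
rewrite -/P in mu_root mu_ge mu_gt nu_root nu_ge.
have hn j : (j < n)%N -> (j <= n.-1)%N by lia.
have mu_nu : mu < nu.
  rewrite ltNge; apply/negP=> /(nu_ge _ n)/(_ (leqnn n)).
  by rewrite (rootP mu_root) ltxx.
(* The factor ['X] of the uncoupled polynomial contributes the eigenvalue 0, which must not exceed
   [mu]. *)
have mu0 : 0 <= mu.
  have := mu_ge mu 1%N (lexx _) (hn _ n1).
  by rewrite /= !hornerE /wdiag subr0 normr_nat subr_gt0 => /ltW; apply: le_trans.
have Pmax r : root (P n) r -> r <= mu.
  by move=> r_root; rewrite leNgt; apply/negP=> /mu_gt; rewrite (rootP r_root) ltxx.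
have /factor_theorem[h1 E1] := mu_root.
have /factor_theorem[h2 E2] := nu_root.
have h1_root r : root h1 r -> r <= mu.
  by move=> hr; apply: Pmax; rewrite E1 rootM hr.
(* A root of the cofactor above [mu] would be a root of P_(n+1) there, hence [nu] by uniqueness,
   making [nu] a multiple root. *)
have h2_root r : root h2 r -> r <= mu.
  move=> hr; rewrite leNgt; apply/negP=> mu_r.
  have Ppos x : mu < x -> forall j, (j <= n)%N -> 0 < (P j).[x].
    move=> mu_x j; rewrite leq_eqVlt => /predU1P[->|/hn]; first exact: mu_gt.
    by apply: mu_ge; apply: ltW.
  have r_root : root (P n.+1) r by rewrite E2 rootM hr.
  have rE : r = nu.
    by apply: continuant_root_uniq r_root nu_root => // j hj; split; apply: Ppos.
  have := continuant_root_simple hc (Ppos nu mu_nu) nu_root.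
  rewrite -/P E2 derivM derivXsubC hornerD !hornerM hornerXsubC subrr mulr0.
  by rewrite add0r hornerC mulr1 -rE (rootP hr) eqxx.
have top2 (X : 'M[R]_(2 * n + 1)) a b h : X^T = X ->
    char_poly X = ('X - a%:P) * ('X - b%:P) * h -> b <= a ->
    (forall r, root h r -> r <= b) ->
    lambda (2 * n + 1) (map_mx (real_complex R) X) = a /\
    lambda (2 * n) (map_mx (real_complex R) X) = b.
  rewrite /lambda (_ : (2 * n + 1).-1 = 2 * n)%N; last by rewrite addn1.
  move=> Xsym Xh ba hb; set t := eigenvalues _; have tE := char_poly_eigenvalues Xsym.
  have st : size t = (2 * n).+1.
    have := size_char_poly X; rewrite tE size_prod_XsubC -/t; lia.
  have := @sorted_prod_XsubC_top2 _ t a b h; rewrite -tE st; apply=> //.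
  exact: sort_le_sorted.
have Wsym : (wilkinson R n)^T = wilkinson R n.
  by rewrite wilkinson_tridiag tridiag_sym.
have Asym : (wilkinson R n - coupling R n)^T = wilkinson R n - coupling R n.
  by rewrite uncoupled_tridiag tridiag_sym.
have [A1 A2] : lambda (2 * n + 1) A = mu /\ lambda (2 * n) A = mu.
  apply: (top2 _ _ _ ('X * h1 ^+ 2)) => //.
    by rewrite char_poly_uncoupled -/P ?E1; [ring | lia].
  move=> r; rewrite rootM => /orP[|hr]; first by rewrite rootX => /eqP->.
  by apply: h1_root; move: hr; rewrite !rootE horner_exp expf_eq0.
have [W1 W2] : lambda (2 * n + 1) W = nu /\ lambda (2 * n) W = mu.
  apply: (top2 _ _ _ (h1 * h2)) => //; last 2 first.
  - exact: ltW.
  - by move=> r; rewrite rootM => /orP[/h1_root|/h2_root].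
  by rewrite char_poly_wilkinson -/P ?E1 ?E2; [ring | lia].
exists mu, nu; split.
- split=> //; first exact: ltW.
  by move=> j /hn hj x mu_x; apply: mu_ge.
- by transitivity mu.
- by congr (_ - _).
Qed.

Theorem mainTheorem3 (R : realType) (n : nat) (n_gt4 : (4 < n)%N)
    (i : nat) (hi : i = (2 * n)%N \/ i = (2 * n + 1)%N) :
  let E := coupling R n in
  let A := wilkinson R n - E in
  `|lambda i (map_mx (real_complex R) (A + E))
    - lambda i (map_mx (real_complex R) A)|
  <= 4 / (3 * n%:R) *
     (\prod_(1 <= l < n.-1) (1 / (n%:R - l%:R - 1))) ^+ 2.
Proof.
cbv zeta; rewrite subrK.
have n_gt1 : (1 < n)%N by lia.
have [mu [nu [[mu_nu mu_root nu_root P_gt0] gap0 gap1]]] :=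
  wilkinson_top_eigenvalues R n_gt1.
have -> : \prod_(1 <= l < n.-1) (1 / (n%:R - l%:R - 1)) = (n.-2`!%:R)^-1 :> R.
  by case: n n_gt1 {n_gt4 hi mu_root nu_root P_gt0 gap0 gap1} => [|[]] // m _;
    rewrite prod_inv_fact.
case: hi => ->.
  rewrite gap0 subrr normr0.
  by rewrite mulr_ge0 ?exprn_ge0 ?divr_ge0 ?mulr_ge0 ?invr_ge0 ?ler0n.
rewrite gap1 ger0_norm; last by rewrite subr_ge0.
clear gap0 gap1.
set m := n.-1; have nE : n = m.+1 by lia.
have m_lt : (m < n)%N by lia.
have m4 : 4 <= m%:R :> R by rewrite ler_nat; lia.
have fE : m`!%:R = m%:R * n.-2`!%:R :> R.
  by rewrite -natrM /m; case: (n) n_gt1 => [|[|k]] // _; rewrite -factS.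
move: mu_root nu_root P_gt0; set d := wdiag R n; set c := even_coupling R n.
move=> /rootP mu_root /rootP nu_root P_gt0.
have hd j : (j < n)%N -> d j = n%:R - j%:R.
  by move=> hj; rewrite /d /wdiag ger0_norm // subr_ge0 ler_nat ltnW.
have hc j : (j.+1 < n)%N -> c j = 1.
  by move=> hj; rewrite /c /even_coupling ltn_eqF.
have n5 : 5 <= n%:R :> R by rewrite ler_nat.
(* P_2(x) = (x - n)(x - n + 1) - 1 equals -1/4 at x = n + 1/2, whereas P_2 is positive from [mu]
   on. *)
have mu_ge : n%:R + 1 / 2 <= mu.
  rewrite leNgt; apply/negP=> /ltW mu_lt.
  have n_gt2 : (2 < n)%N by lia.
  have := P_gt0 2%N n_gt2 _ mu_lt; rewrite horner_continuantSS /= hornerC !hornerE.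
  rewrite hc ?hd ?subr0; try lia.
  by nra.
have nu_ge := le_trans mu_ge mu_nu.
have [A0 B0] := (P_gt0 m m_lt nu mu_nu, P_gt0 m m_lt mu (lexx mu)).
have Pnu : nu * (continuant d c n).[nu] = 2 * (continuant d c m).[nu].
  move: nu_root; rewrite nE horner_continuantSS -nE.
  rewrite /d /wdiag subrr normr0 subr0 /c /even_coupling -nE eqxx => /eqP.
  by rewrite subr_eq0 => /eqP.
have Afact : m`!%:R * (continuant d c m).[nu] <= 1.
  apply: (@continuant_decay _ d c n nu) => // [j hj|]; first exact: P_gt0.
  (* 2 P_n(nu) = (4 / nu) P_(n-1)(nu), and nu > 4. *)
  by rewrite -/m; nra.
have Bfact : m`!%:R * (continuant d c m).[mu] <= 1.
  apply: (@continuant_decay _ d c n mu) => // [j hj|]; first exact: P_gt0.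
  by rewrite mu_root mulr0 ltW.
have D1 : 1 <= christoffel d c nu mu m.
  apply: christoffel_ge1 => j; first by rewrite ler1n.
  by rewrite -ltnS -nE => hj; split; apply: P_gt0.
have := christoffel_darboux d c nu mu m.
rewrite -nE mu_root mul0r subr0 => CD.
have g0 : 0 < (n.-2`!%:R : R) by rewrite ltr0n fact_gt0.
move: Afact Bfact Pnu CD A0 B0 g0; rewrite fE.
set A := (continuant d c m).[nu]; set B := (continuant d c m).[mu].
set p := (continuant d c n).[nu]; set g := n.-2`!%:R.
move=> Afact Bfact Pnu CD A0 B0 g0.
have gap : (nu - mu) * n%:R <= 2 * (A * B).
  have gapD : nu - mu <= p * B by rewrite CD ler_peMr // subr_ge0.
  have : (nu - mu) * nu <= 2 * (A * B).
    have -> : 2 * (A * B) = p * B * nu by rewrite mulrA -Pnu; ring.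
    by rewrite ler_wpM2r //; lra.
  by apply: le_trans; rewrite ler_wpM2l ?subr_ge0 //; lra.
(* Here (n-1)! = (n-1) g with n - 1 >= 4. Hence 16 g^2 A B <= 1, so the gap times n g^2 is at most
   1/8, well below the required 4/3. *)
have Ag : 4 * g * A <= 1.
  by apply: le_trans Afact; rewrite !ler_wpM2r // ltW.
have Bg : 4 * g * B <= 1.
  by apply: le_trans Bfact; rewrite !ler_wpM2r // ltW.
have ABg : (4 * g * A) * (4 * g * B) <= 1.
  by rewrite mulr_ile1 // !mulr_ge0 // ltW.
have -> : 4 / (3 * n%:R) * g^-1 ^+ 2 = 4 / (3 * n%:R * g ^+ 2).
  by field; rewrite gt_eqF //= gt_eqF //; lra.
rewrite ler_pdivlMr; last by rewrite !mulr_gt0 ?exprn_gt0 //; lra.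
have : (nu - mu) * n%:R * g ^+ 2 <= 2 * (A * B) * g ^+ 2.
  by rewrite ler_wpM2r // exprn_ge0 // ltW.
lra.
Qed.
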